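(* Let $A\in\mathbb{C}^{m\times n}$ with $m\ge n$, let $1\le k_1<\min(k_m,k_n)$ with $k_m\le m$, $k_n\le n$, and let $[\widehat U_1\ \widehat U_2\ \widehat U_3]$ and $[\widehat V_1\ \widehat V_2\ \widehat V_3]$ be square unitary matrices, with $\widehat U_1,\widehat U_2,\widehat U_3$ having $k_1$, $k_m-k_1$, $m-k_m$ columns and $\widehat V_1,\widehat V_2,\widehat V_3$ having $k_1$, $k_n-k_1$, $n-k_n$ columns, such that $$[\widehat U_1\ \widehat U_2\ \widehat U_3]^*A[\widehat V_1\ \widehat V_2\ \widehat V_3]=\begin{bmatrix}\widehat\Sigma_1&0&R_1\\0&\widehat\Sigma_2&R_2\\S_1&S_2&A_3\end{bmatrix},$$ where $\widehat\Sigma_1\in\mathbb{R}^{k_1\times k_1}$, $\widehat\Sigma_2\in\mathbb{R}^{(k_m-k_1)\times(k_n-k_1)}$, and $\mathrm{diag}(\widehat\Sigma_1,\widehat\Sigma_2)$ equals $\begin{bmatrix}\mathrm{diag}(\widehat\sigma_1,\ldots,\widehat\sigma_k)\\0\end{bmatrix}$ if $k_m\ge k_n=k$ and $[\mathrm{diag}(\widehat\sigma_1,\ldots,\widehat\sigma_k)\ \ 0_{k\times(k_n-k)}]$ if $k=k_m<k_n$. Let $(\Sigma_1,U_1,V_1)$ be the $k_1$ leading singular triplets of $A$ (so $\Sigma_1=\mathrm{diag}(\sigma_1(A),\ldots,\sigma_{k_1}(A))$, $AV_1=U_1\Sigma_1$, $U_1^*A=\Sigma_1V_1^*$, $U_1,V_1$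 with orthonormal columns). Define $\mathrm{Gap}=\min(\sigma(\widehat\Sigma_1)-\sigma(A_3))$ and $\mathrm{gap}=\sigma_{\min}(\Sigma_1)-\|\widehat\Sigma_2\|$, and suppose $\mathrm{Gap}>0$ and $\mathrm{gap}>0$. Write $S=[S_1\ S_2]$, $R=\begin{bmatrix}R_1\\R_2\end{bmatrix}$, and for a unitarily invariant norm $|||\cdot|||$ let $|||\Theta|||=\max(|||\sin\angle(U_1,\widehat U_1)|||,\ |||\sin\angle(V_1,\widehat V_1)|||)$. Then for every unitarily invariant norm: (i) $$|||\Theta|||\le\frac{\max(|||R|||,|||S|||)}{\mathrm{Gap}}\Big(1+\frac{\max(\|R_2\|,\|S_2\|)}{\mathrm{gap}}\Big);$$ (ii) if $\mathrm{Gap}>\max(\|S_2\|,\|R_2\|)^2/\mathrm{gap}$, then $$|||\Theta|||\le\frac{\max(|||S_1|||,|||R_1|||)}{\mathrm{Gap}-\frac{\max(\|S_2\|,\|R_2\|)^2}{\mathrm{gap}}}\Big(1+\frac{\max(\|R_2\|,\|S_2\|)}{\mathrm{gap}}\Big);$$ (iii) let $k'=\max(k_m-k_1,k_n-k_1)$, let $r_{2i}^T$ be the $i$-th row of $R_2$ and $s_{2i}$ the $i$-th column of $S_2$, with the conventions $r_{2i}=0$ for $i>k_m-k_1$, $s_{2i}=0$ for $i>k_n-k_1$, and $\widehat\sigma_{k_1+i}=0$ for $i>\min(k_m,k_n)-k_1$. If $\mathrm{Gap}>\sum_{i=1}^{k'}\frac{\max(\|r_{2i}\|,\|s_{2i}\|)^2}{\sigma_{\min}(\Sigma_1)-\widehat\sigma_{k_1+i}}$,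 then $$|||\Theta|||\le\frac{\max(|||S_1|||,|||R_1|||)}{\mathrm{Gap}-\sum_{i=1}^{k'}\frac{\max(\|r_{2i}\|,\|s_{2i}\|)^2}{\sigma_{\min}(\Sigma_1)-\widehat\sigma_{k_1+i}}}\Big(1+\sum_{i=1}^{k'}\frac{\max(\|r_{2i}\|,\|s_{2i}\|)}{\sigma_{\min}(\Sigma_1)-\widehat\sigma_{k_1+i}}\Big).$$
   Context: $\|\cdot\|$ without subscript is the spectral norm (Euclidean norm for vectors). $\sigma(M)$ is the set of singular values of $M$, $\sigma_{\min}$ the smallest one, and $\min(\sigma(\widehat\Sigma_1)-\sigma(A_3))$ means the minimum of $a-b$ over $a\in\sigma(\widehat\Sigma_1)$, $b\in\sigma(A_3)$, i.e. $\sigma_{\min}(\widehat\Sigma_1)-\|A_3\|$. For matrices $X,\widehat X$ with $p$ orthonormal columns each, the canonical angles are $\theta_i=\arccos\sigma_i(X^*\widehat X)$, and $\sin\angle(X,\widehat X)=\mathrm{diag}(\sin\theta_1,\ldots,\sin\theta_p)$. Blocks $R$ or $S$ may be empty.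
   Formalization: The diagonal entries σ̂_i of diag(Σ̂_1, Σ̂_2) are assumed nonnegative, as approximate singular values; with a negative entry in Σ̂_2 bound (iii) can fail, while (i) and (ii) reduce to this case by changing signs of columns of V̂. *)

(* Defs.v *)
(* Complex scalars: an arbitrary numClosedFieldType C
   (e.g. algC, or R[i] for R real closed, in particular the complex numbers). *)
From HB Require Import structures.
From mathcomp Require Import all_boot all_order all_algebra.
Set Implicit Arguments. Unset Strict Implicit. Unset Printing Implicit Defensive.
Import Order.TTheory GRing.Theory Num.Theory.
Local Open Scope ring_scope.
Local Open Scope sesquilinear_scope.

Section Defs.
Variable C : numClosedFieldType.

Definition gram_eigs m n (A : 'M[C]_(m, n)) : seq C :=
  sort (fun x y : C => y <= x)
    [seq spectral_diag (A ^t* *m A) 0 i | i <- enum 'I_n].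

(* singular values sigma_1 >= sigma_2 >= ... : square roots of the eigenvalues
   of A^* A.  (When m < n this list has n - m trailing zeros, which are
   irrelevant for the uses below: the largest singular value of any matrix and
   the smallest singular value of square matrices.) *)
Definition sing_vals m n (A : 'M[C]_(m, n)) : seq C :=
  [seq sqrtC x | x <- gram_eigs A].

(* sigma_{i+1}(A) (0-indexed) *)
Definition sing_val m n (A : 'M[C]_(m, n)) (i : nat) : C := nth 0 (sing_vals A) i.

(* spectral norm ||A|| = largest singular value (0 for empty matrices) *)
Definition spnorm m n (A : 'M[C]_(m, n)) : C := sing_val A 0.

Definition smin p (A : 'M[C]_p) : C := last 0 (sing_vals A).

Definition vnorm n (v : 'rV[C]_n) : C := sqrtC (\sum_j `|v 0 j| ^+ 2).

Definition rownorm p q (M : 'M[C]_(p, q)) (i : nat) : C :=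
  if insub i is Some i' then vnorm (row i' M) else 0.

Definition colnorm p q (M : 'M[C]_(p, q)) (i : nat) : C := rownorm M^T i.

(* sin of the canonical angles between X and Xh (p orthonormal columns each):
   theta_i = arccos sigma_i(X^* Xh), so sin theta_i = sqrt(1 - sigma_i^2). *)
Definition sin_angle m p (X Xh : 'M[C]_(m, p)) : 'M[C]_p :=
  diag_mx (\row_(i < p) sqrtC (1 - (sing_val (X ^t* *m Xh) i) ^+ 2)).

(* A unitarily invariant norm, given on matrices of all sizes consistently
   (value unchanged by padding with zero rows/columns). *)
Definition unitarily_invariant_norm
  (N : forall m n, 'M[C]_(m, n) -> C) : Prop :=
  (forall m n (A : 'M[C]_(m, n)), 0 <= N m n A) /\
  (forall m n (A : 'M[C]_(m, n)), N m n A = 0 -> A = 0) /\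
      (forall m n (a : C) (A : 'M[C]_(m, n)), N m n (a *: A) = `|a| * N m n A) /\
      (forall m n (A B : 'M[C]_(m, n)), N m n (A + B) <= N m n A + N m n B) /\
      (forall m n (U : 'M[C]_m) (V : 'M[C]_n) (A : 'M[C]_(m, n)),
          U \is unitarymx -> V \is unitarymx -> N m n (U *m A *m V) = N m n A) /\
    (forall m n p q (A : 'M[C]_(m, n)),
          N (m + p)%N (n + q)%N (block_mx A 0 0 (0 : 'M[C]_(p, q))) = N m n A).

End Defs.

(* Main.v *)
Require Import Defs.
From HB Require Import structures.
From mathcomp Require Import all_boot all_order all_algebra.
From mathcomp Require Import perm ring.
Import Order.TTheory GRing.Theory Num.Theory.
Local Open Scope ring_scope.
Local Open Scope sesquilinear_scope.
Set Implicit Arguments.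
Unset Strict Implicit.

(* Write U^t* U1 = [U11; U21; U31] and V^t* V1 = [V11; V21; V31] for the blocks of
   the exact singular vectors in the approximate bases, s for the smallest entry
   of Sig1 and M for max(|||U31|||, |||V31|||).  The sines of the canonical angles
   are the singular values of [U21; U31] (resp. [V21; V31]), so Theta is at most
   max(|||U21|||, |||V21|||) + M.  The block rows of A V1 = U1 Sig1 and of its
   adjoint counterpart give pairs of coupled inequalities s x <= b y + e,
   s y <= b x + e, hence max(x, y) <= e / (s - b).  The second row bounds U21 and
   V21 by (rho / gap) M, or row by row by (t_i / d_i) M; the third row then bounds
   M, where s may be replaced by the smallest singular value of Sh1 by
   interlacing. *)

(** * Algebra of the conjugate transpose *)

Lemma adjmxM (C : numClosedFieldType) m n p (A : 'M[C]_(m, n)) (B : 'M[C]_(n, p)) :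
  (A *m B)^t* = B^t* *m A^t*.
Proof. by rewrite trmx_mul map_mxM. Qed.

Lemma adjmxB (C : numClosedFieldType) m n (A B : 'M[C]_(m, n)) :
  (A - B)^t* = A^t* - B^t*.
Proof. by apply/matrixP=> i j; rewrite !mxE rmorphB. Qed.

Lemma adjmxZ (C : numClosedFieldType) m n (a : C) (A : 'M[C]_(m, n)) :
  (a *: A)^t* = a^* *: A^t*.
Proof. by apply/matrixP=> i j; rewrite !mxE rmorphM. Qed.

Lemma adjmx0 (C : numClosedFieldType) m n : (0 : 'M[C]_(m, n))^t* = 0.
Proof. by apply/matrixP=> i j; rewrite !mxE conjC0. Qed.

Lemma adjmx1 (C : numClosedFieldType) n : (1%:M : 'M[C]_n)^t* = 1%:M.
Proof. by rewrite trmx1 map_mx1. Qed.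

Lemma adj_diag_mx (C : numClosedFieldType) n (d : 'rV[C]_n) :
  (diag_mx d)^t* = diag_mx (map_mx Num.conj d).
Proof. by rewrite tr_diag_mx map_diag_mx. Qed.

Lemma adj_diag_mx_real (C : numClosedFieldType) n (d : 'rV[C]_n) :
  (forall i, d 0 i \is Num.real) -> (diag_mx d)^t* = diag_mx d.
Proof.
move=> dR; rewrite adj_diag_mx; congr diag_mx.
by apply/rowP=> i; rewrite mxE; apply/CrealP.
Qed.

Lemma adj_row_mx (C : numClosedFieldType) m n p (A : 'M[C]_(m, n)) (B : 'M[C]_(m, p)) :
  (row_mx A B)^t* = col_mx (A^t*) (B^t*).
Proof. by rewrite tr_row_mx map_col_mx. Qed.

Lemma adj_col_mx (C : numClosedFieldType) m n p (A : 'M[C]_(m, n)) (B : 'M[C]_(p, n)) :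
  (col_mx A B)^t* = row_mx (A^t*) (B^t*).
Proof. by rewrite tr_col_mx map_row_mx. Qed.

Lemma adj_block_mx (C : numClosedFieldType) m1 m2 n1 n2 (A : 'M[C]_(m1, n1))
    (B : 'M[C]_(m1, n2)) (D : 'M[C]_(m2, n1)) (E : 'M[C]_(m2, n2)) :
  (block_mx A B D E)^t* = block_mx (A^t*) (D^t*) (B^t*) (E^t*).
Proof. by rewrite tr_block_mx map_block_mx. Qed.

Lemma unitarymx_adj1 (C : numClosedFieldType) m n (X : 'M[C]_(m, n)) :
  X^t* \is unitarymx -> X^t* *m X = 1%:M.
Proof. by move/unitarymxP; rewrite trmxCK. Qed.

(** * Squared Euclidean norms and operator bounds *)

Definition sqnorm (C : numClosedFieldType) m (v : 'cV[C]_m) : C := (v^t* *m v) 0 0.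

Lemma sqnormE (C : numClosedFieldType) m (v : 'cV[C]_m) :
  sqnorm v = \sum_i `|v i 0| ^+ 2.
Proof. by rewrite /sqnorm mxE; apply: eq_bigr => i _; rewrite !mxE normCKC. Qed.

Lemma sqnorm_ge0 (C : numClosedFieldType) m (v : 'cV[C]_m) : 0 <= sqnorm v.
Proof. by rewrite sqnormE sumr_ge0 // => i _; rewrite exprn_ge0. Qed.

Lemma sqnorm_eq0 (C : numClosedFieldType) m (v : 'cV[C]_m) : sqnorm v = 0 -> v = 0.
Proof.
rewrite sqnormE => /psumr_eq0P v0; apply/colP=> i; rewrite mxE.
apply/eqP; rewrite -normr_eq0 -sqrf_eq0; apply/eqP.
by apply: v0 => // j _; rewrite exprn_ge0.
Qed.

Lemma sqnorm_mul (C : numClosedFieldType) m n (K : 'M[C]_(m, n)) (v : 'cV[C]_n) :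
  sqnorm (K *m v) = (v^t* *m (K^t* *m K) *m v) 0 0.
Proof. by rewrite /sqnorm adjmxM !mulmxA. Qed.

Lemma sqnorm_isom (C : numClosedFieldType) m n (K : 'M[C]_(m, n)) (v : 'cV[C]_n) :
  K^t* *m K = 1%:M -> sqnorm (K *m v) = sqnorm v.
Proof. by move=> K1; rewrite sqnorm_mul K1 mulmx1. Qed.

Lemma sqnorm_scale (C : numClosedFieldType) m (a : C) (v : 'cV[C]_m) :
  sqnorm (a *: v) = `|a| ^+ 2 * sqnorm v.
Proof.
by rewrite !sqnormE mulr_sumr; apply: eq_bigr => i _; rewrite mxE normrM exprMn.
Qed.

Lemma sqnormB (C : numClosedFieldType) m (u v : 'cV[C]_m) :
  sqnorm (u - v) = sqnorm u - (u^t* *m v) 0 0 - (v^t* *m u) 0 0 + sqnorm v.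
Proof.
rewrite /sqnorm adjmxB mulmxBr !mulmxBl.
move: (u^t* *m u) (u^t* *m v) (v^t* *m u) (v^t* *m v) => a b c d.
by rewrite !mxE; ring.
Qed.

Lemma sqnorm_col_mx (C : numClosedFieldType) m n (u : 'cV[C]_m) (v : 'cV[C]_n) :
  sqnorm (col_mx u v) = sqnorm u + sqnorm v.
Proof. by rewrite /sqnorm adj_col_mx mul_row_col mxE. Qed.

(** An eigenvalue-free form of a bound on the spectral norm. It does not fix the sign of [c], so
    results that need [0 <= c] assume it. *)
Definition opbound {C : numClosedFieldType} {m n} (c : C) (K : 'M[C]_(m, n)) :=
  forall v : 'cV[C]_n, sqnorm (K *m v) <= c ^+ 2 * sqnorm v.

(* If H = P^t* diag(c x_i) P with x_i in [-1, 1], then W = P^t* diag(w_i) P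
   with w_i = x_i + 'i sqrt(1 - x_i^2) of modulus 1. *)
Lemma herm_opbound_unitary (C : numClosedFieldType) n (H : 'M[C]_n) (c : C) :
  0 <= c -> H^t* = H -> opbound c H ->
  exists2 W : 'M[C]_n, W \is unitarymx & H = (c / 2) *: (W + W^t*).
Proof.
move=> c0 HH Hc.
have Hherm : H \is hermsymmx.
  by rewrite is_hermitianmxE expr0 scale1r; apply/eqP/esym.
have Heq := orthomx_spectralP (hermitian_normalmx Hherm).
have sR := hermitian_spectral_diag_real Hherm.
set P := spectralmx H in Heq; set s := spectral_diag H in Heq sR.
have PU : P \is unitarymx by apply: spectral_unitarymx.
rewrite invmx_unitary // in Heq.
have PP : P *m P^t* = 1%:M by apply/unitarymxP.
have siR i : s 0 i \is Num.real by apply: (mxOverP sR).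
have PP' : P^t* *m P = 1%:M by rewrite -(invmx_unitary PU) mulVmx // unitarymx_unit.
have sc i : s 0 i ^+ 2 <= c ^+ 2.
  (* Test the bound on the [i]-th eigenvector. *)
  have := Hc (P^t* *m delta_mx i 0).
  rewrite {1}Heq -!mulmxA [P *m (_ *m _)]mulmxA PP mul1mx.
  have -> : diag_mx s *m delta_mx i 0 = s 0 i *: delta_mx i (0 : 'I_1).
    apply/colP=> j; rewrite mul_diag_mx !mxE eqxx andbT.
    by case: eqVneq => [->|]; rewrite ?mulr0.
  have iso : P^t* ^t* *m P^t* = 1%:M by rewrite trmxCK.
  rewrite !sqnorm_isom // sqnorm_scale real_normK //.
  suff -> : sqnorm (delta_mx i 0 : 'cV[C]_n) = 1 by rewrite !mulr1.
  rewrite sqnormE (bigD1 i) //= big1 ?addr0 ?mxE ?eqxx ?normr1 ?expr1n //.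
  by move=> j /negPf ji; rewrite mxE ji normr0 expr0n.
(* For [c = 0] the quotient is [0], and [sc] forces [s 0 i = 0], so [c * x i = s 0 i] still
   holds. *)
pose x i := s 0 i / c.
have xR i : x i \is Num.real by apply: realM => //; rewrite realV ger0_real.
have x1 i : x i ^+ 2 <= 1.
  rewrite /x expr_div_n; have [->|cn0] := eqVneq c 0.
    by rewrite expr0n /= invr0 mulr0 ler01.
  by rewrite ler_pdivrMr ?mul1r // exprn_gt0 // lt_def cn0.
have cx i : c * x i = s 0 i.
  rewrite /x; have [cE|cn0] := eqVneq c 0; last by rewrite mulrC divfK.
  rewrite cE mul0r; apply/esym/eqP; rewrite -sqrf_eq0; apply/eqP/le_anti.
  by rewrite real_exprn_even_ge0 // andbT (le_trans (sc i)) // cE expr0n.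
pose y i := sqrtC (1 - x i ^+ 2).
have yR i : y i \is Num.real by rewrite sqrtC_real // subr_ge0.
pose w : 'rV[C]_n := \row_i (x i + 'i * y i).
have wwE i : w 0 i * (w 0 i)^* = 1.
  rewrite mxE conjC_rect // mulrC -subr_sqr [('i * _) ^+ 2]exprMn sqrCi mulN1r opprK.
  by rewrite sqrtCK addrC subrK.
exists (P^t* *m diag_mx w *m P).
  apply/unitarymxP; rewrite !adjmxM trmxCK !mulmxA.
  rewrite -[_ *m P *m P^t*]mulmxA PP mulmx1.
  rewrite -[P^t* *m _ *m _]mulmxA adj_diag_mx mulmx_diag.
  suff -> : \row_j (w 0 j * (map_mx Num.conj w) 0 j) = const_mx 1.
    by rewrite diag_const_mx mulmx1.
  by apply/rowP=> i; rewrite [LHS]mxE [X in _ * X]mxE wwE mxE.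
rewrite !adjmxM trmxCK adj_diag_mx mulmxA -mulmxDl -mulmxDr -linearD /=.
rewrite scalemxAl scalemxAr -linearZ /= Heq; congr (_ *m diag_mx _ *m _).
apply/rowP=> i; rewrite !mxE conjC_rect //.
by rewrite addrACA subrr addr0 -mulr2n -(mulr_natl (x i)) mulrA divfK ?pnatr_eq0 ?cx.
Qed.

(* Expand 0 <= |c^2 v - K K^t* v|^2. *)
Lemma opbound_adj (C : numClosedFieldType) m n (c : C) (K : 'M[C]_(m, n)) :
  0 <= c -> opbound c K -> opbound c (K^t*).
Proof.
move=> c0 Kc v; pose w := K^t* *m v.
have wE : sqnorm w = (v^t* *m (K *m w)) 0 0.
  by rewrite /w sqnorm_mul trmxCK -!mulmxA.
have wE' : sqnorm w = ((K *m w)^t* *m v) 0 0.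
  by rewrite adjmxM -mulmxA.
have Kw := Kc w; rewrite -/w.
(* The expansion gives the bound only after division by [c ^+ 2]. For [c = 0], [K *m w] vanishes and
   [wE] concludes. *)
have [cE|cn0] := eqVneq c 0.
  move: Kw; rewrite cE expr0n /= !mul0r => Kw.
  have /sqnorm_eq0 Kw0 : sqnorm (K *m w) = 0.
    by apply/le_anti; rewrite Kw sqnorm_ge0.
  by rewrite wE Kw0 mulmx0 mxE.
have c2 : 0 < c ^+ 2 by rewrite exprn_gt0 // lt_def cn0.
have cR : (c ^+ 2)^* = c ^+ 2 by apply/CrealP; rewrite ger0_real // ltW.
have : 0 <= sqnorm (c ^+ 2 *: v - K *m w) by apply: sqnorm_ge0.
have -> : sqnorm (c ^+ 2 *: v - K *m w) =
    c ^+ 2 * (c ^+ 2 * sqnorm v) - c ^+ 2 * sqnorm w - c ^+ 2 * sqnorm w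
    + sqnorm (K *m w).
  rewrite sqnormB sqnorm_scale -scalemxAr adjmxZ cR -scalemxAl.
  rewrite ger0_norm ?ltW // expr2 -mulrA.
  congr (_ - _ - _ + _).
    by rewrite mxE wE.
  by rewrite mxE wE'.
move=> le0; rewrite -subr_ge0 -(pmulr_rge0 _ c2) mulrBr.
apply: le_trans le0 _; rewrite -addrA -[leRHS]addr0 lerD2l.
by rewrite addrC subr_le0.
Qed.

Lemma opbound_isom (C : numClosedFieldType) m n (K : 'M[C]_(m, n)) :
  K^t* *m K = 1%:M -> opbound 1 K.
Proof. by move=> K1 v; rewrite sqnorm_isom // expr1n mul1r. Qed.

(** * Spectral calculus of the Gram matrix *)

Lemma gram_spectral (C : numClosedFieldType) m n (A : 'M[C]_(m, n)) :
  let G := A^t* *m A in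
  [/\ spectralmx G *m (spectralmx G)^t* = 1%:M,
      (spectralmx G)^t* *m spectralmx G = 1%:M,
      G = (spectralmx G)^t* *m diag_mx (spectral_diag G) *m spectralmx G
    & forall i, 0 <= spectral_diag G 0 i].
Proof.
move=> G; have PU : spectralmx G \is unitarymx by apply: spectral_unitarymx.
have PP : spectralmx G *m (spectralmx G)^t* = 1%:M by apply/unitarymxP.
have PP' : (spectralmx G)^t* *m spectralmx G = 1%:M.
  by rewrite -(invmx_unitary PU) mulVmx // unitarymx_unit.
have GG : G^t* = G by rewrite /G adjmxM trmxCK.
have /hermitian_normalmx/orthomx_spectralP : G \is hermsymmx.
  by rewrite is_hermitianmxE expr0 scale1r; apply/eqP/esym.
rewrite invmx_unitary // => Heq; split=> // i.
set P := spectralmx G in PP PP' Heq *; set s := spectral_diag G in Heq *.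
(* The eigenvalues are diagonal entries of the Gram matrix of [A *m P^t*], hence nonnegative. *)
have : diag_mx s = (A *m P^t*)^t* *m (A *m P^t*).
  rewrite adjmxM trmxCK mulmxA -[_ *m _^t* *m A]mulmxA -/G Heq !mulmxA PP mul1mx.
  by rewrite -mulmxA PP mulmx1.
move/matrixP/(_ i i); rewrite mxE eqxx mulr1n => ->.
rewrite mxE sumr_ge0 // => j _.
by rewrite 2!mxE mulrC mul_conjC_ge0.
Qed.

(** [F f] applies [f] to the eigenvalues of [A^t* *m A] in a fixed eigenbasis. Conditions on [f] are
    asked only for [0 <= x] because these eigenvalues are nonnegative. *)
Lemma gram_calculus (C : numClosedFieldType) m n (A : 'M[C]_(m, n)) :
  exists F : (C -> C) -> 'M[C]_n,
  [/\ F id = A^t* *m A,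
      forall f g, F f *m F g = F (fun x => f x * g x),
      forall f g, F (fun x => f x - g x) = F f - F g,
      F (fun=> 1) = 1%:M &
  [/\ forall f, (forall x, 0 <= x -> f x \is Num.real) -> (F f)^t* = F f,
      forall f g, (forall x, 0 <= x -> f x = g x) -> F f = F g &
      forall f (v : 'cV_n), (forall x, 0 <= x -> f x <= 1) ->
        (v^t* *m F f *m v) 0 0 <= sqnorm v]].
Proof.
have [PP PP' GE s_ge0] := gram_spectral A.
set G := A^t* *m A in PP PP' GE s_ge0 *.
set P := spectralmx G in PP PP' GE; set s := spectral_diag G in GE s_ge0.
exists (fun f => P^t* *m diag_mx (map_mx f s) *m P); split; last split.
- by rewrite [RHS]GE; congr (_ *m diag_mx _ *m _); apply/rowP=> i; rewrite !mxE.
- move=> f g; rewrite !mulmxA -[_ *m P *m P^t*]mulmxA PP mulmx1.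
  rewrite -[P^t* *m _ *m diag_mx _]mulmxA mulmx_diag; congr (_ *m diag_mx _ *m _).
  by apply/rowP=> i; rewrite !mxE.
- move=> f g; rewrite -mulmxBl -mulmxBr -linearB; congr (_ *m diag_mx _ *m _).
  by apply/rowP=> i; rewrite !mxE.
- rewrite (_ : map_mx _ s = const_mx 1) ?diag_const_mx ?mulmx1 //.
  by apply/rowP=> i; rewrite !mxE.
- move=> f fR; rewrite !adjmxM trmxCK mulmxA adj_diag_mx_real // => i.
  by rewrite mxE fR.
- move=> f g fg; congr (_ *m diag_mx _ *m _).
  by apply/rowP=> i; rewrite !mxE fg.
move=> f v f1; have <- : sqnorm (P *m v) = sqnorm v by rewrite sqnorm_isom.
have -> : v^t* *m (P^t* *m diag_mx (map_mx f s) *m P) *m v =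
  (P *m v)^t* *m (diag_mx (map_mx f s) *m (P *m v)) by rewrite adjmxM !mulmxA.
rewrite sqnormE mxE ler_sum // => i _.
rewrite mul_diag_mx !mxE mulrCA -normCKC ler_piMl ?exprn_ge0 //.
exact: f1.
Qed.

(** * Unitarily invariant norms *)

Section UnitarilyInvariantNorm.

Variables (C : numClosedFieldType) (N : forall m n, 'M[C]_(m, n) -> C).
Hypothesis Ninv : unitarily_invariant_norm N.

Lemma uinorm_ge0 m n (A : 'M[C]_(m, n)) : 0 <= N A.
Proof. by case: Ninv. Qed.

Lemma uinormZ m n (a : C) (A : 'M[C]_(m, n)) : N (a *: A) = `|a| * N A.
Proof. by case: Ninv => _ [_ []]. Qed.

Lemma uinormD m n (A B : 'M[C]_(m, n)) : N (A + B) <= N A + N B.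
Proof. by case: Ninv => _ [_ [_ []]]. Qed.

Lemma uinorm0 m n : N (0 : 'M[C]_(m, n)) = 0.
Proof. by rewrite -(scale0r (0 : 'M[C]_(m, n))) uinormZ normr0 mul0r. Qed.

Lemma uinorm_sum m n (I : finType) (P : pred I) (F : I -> 'M[C]_(m, n)) :
  N (\sum_(i | P i) F i) <= \sum_(i | P i) N (F i).
Proof.
elim/big_rec2: _ => [|i x A _ IH]; first by rewrite uinorm0.
by apply: le_trans (uinormD _ _) _; rewrite lerD2l.
Qed.

Lemma uinorm_pad m n p q (A : 'M[C]_(m, n)) :
  N (block_mx A 0 0 (0 : 'M_(p, q))) = N A.
Proof. by case: Ninv => _ [_ [_ [_ []]]]. Qed.

(** The equality [m = m'] admits the block swap below, whose sizes [p + m] and [m + p] are not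
    convertible. *)
Lemma uinorm_unitaryl m m' n (U : 'M[C]_(m', m)) (A : 'M[C]_(m, n)) :
  m = m' -> U \is unitarymx -> N (U *m A) = N A.
Proof.
move=> e; case: m' / e U => U UU.
case: Ninv => _ [_ [_ [_ [H _]]]]; rewrite -[LHS](_ : N (U *m A *m 1%:M) = _).
  by apply: H => //; apply/unitarymxP; rewrite adjmx1 mulmx1.
by rewrite mulmx1.
Qed.

Lemma uinorm_unitaryr m n n' (U : 'M[C]_(n, n')) (A : 'M[C]_(m, n)) :
  n = n' -> U \is unitarymx -> N (A *m U) = N A.
Proof.
move=> e; case: n' / e U => U UU.
case: Ninv => _ [_ [_ [_ [H _]]]]; rewrite -[LHS](_ : N (1%:M *m A *m U) = _).
  by apply: H => //; apply/unitarymxP; rewrite adjmx1 mulmx1.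
by rewrite mul1mx.
Qed.

(** The padding axiom speaks of the upper left corner; this permutation carries the block to the
    lower left or upper right one. *)
Lemma swap_unitary m p : (block_mx 0 1%:M 1%:M 0 : 'M[C]_(p + m, m + p)) \is unitarymx.
Proof.
apply/unitarymxP; rewrite adj_block_mx !adjmx1 !adjmx0 mulmx_block.
by rewrite !mulmx0 !mul0mx !mulmx1 !addr0 !add0r -scalar_mx_block.
Qed.

Lemma uinorm_pad_dl m n p q (A : 'M[C]_(m, n)) :
  N (block_mx 0 0 A 0 : 'M_(p + m, n + q)) = N A.
Proof.
rewrite -(uinorm_pad p q A) -(uinorm_unitaryl _ (addnC m p) (swap_unitary m p)).
by rewrite mulmx_block !mulmx0 !mul0mx mul1mx !addr0 ?add0r.
Qed.

Lemma uinorm_pad_ur m n p q (A : 'M[C]_(m, n)) :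
  N (block_mx 0 A 0 0 : 'M_(m + p, q + n)) = N A.
Proof.
rewrite -(uinorm_pad p q A) -(uinorm_unitaryr _ (addnC n q) (swap_unitary q n)).
by rewrite mulmx_block !mulmx0 !mul0mx mulmx1 !addr0 ?add0r.
Qed.

(** [H] is [c / 2] times a sum of two unitary matrices, so invariance and the triangle inequality
    suffice. *)
Lemma uinorm_herm_mull n p (H : 'M[C]_n) (X : 'M[C]_(n, p)) c :
  0 <= c -> H^t* = H -> opbound c H -> N (H *m X) <= c * N X.
Proof.
move=> c0 HH Hc; have [W WU ->] := herm_opbound_unitary c0 HH Hc.
rewrite -scalemxAl mulmxDl uinormZ ger0_norm ?divr_ge0 //.
apply: le_trans (ler_wpM2l _ (uinormD _ _)) _; first by rewrite divr_ge0.
rewrite !uinorm_unitaryl // ?trmxC_unitary //.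
by rewrite -mulr2n -(mulr_natl (N X)) mulrA divfK ?pnatr_eq0.
Qed.

Lemma uinorm_herm_mulr n p (H : 'M[C]_n) (X : 'M[C]_(p, n)) c :
  0 <= c -> H^t* = H -> opbound c H -> N (X *m H) <= c * N X.
Proof.
move=> c0 HH Hc; have [W WU ->] := herm_opbound_unitary c0 HH Hc.
rewrite -scalemxAr mulmxDr uinormZ ger0_norm ?divr_ge0 //.
apply: le_trans (ler_wpM2l _ (uinormD _ _)) _; first by rewrite divr_ge0.
rewrite !uinorm_unitaryr // ?trmxC_unitary //.
by rewrite -mulr2n -(mulr_natl (N X)) mulrA divfK ?pnatr_eq0.
Qed.

Lemma herm_dilation_adj m n (K : 'M[C]_(m, n)) :
  (block_mx 0 K (K^t*) 0)^t* = block_mx 0 K (K^t*) 0.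
Proof. by rewrite adj_block_mx !adjmx0 trmxCK. Qed.

(** The dilation sends [col_mx u w] to [col_mx (K *m w) (K^t* *m u)], so the bounds for [K] and its
    adjoint add up. *)
Lemma herm_dilation_opbound m n (K : 'M[C]_(m, n)) c :
  0 <= c -> opbound c K -> opbound c (block_mx 0 K (K^t*) 0).
Proof.
move=> c0 Kc v; rewrite -(vsubmxK v) mul_block_col !mul0mx add0r addr0.
rewrite !sqnorm_col_mx mulrDr addrC lerD ?Kc //.
exact: opbound_adj.
Qed.

(* K is the upper right block of its Hermitian dilation, which satisfies the
   same bound and is therefore c times an average of two unitary matrices. *)
Lemma uinorm_mull m n p (K : 'M[C]_(m, n)) (X : 'M[C]_(n, p)) c :
  0 <= c -> opbound c K -> N (K *m X) <= c * N X.
Proof.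
move=> c0 Kc; rewrite -(uinorm_pad n p (K *m X)) -(uinorm_pad_dl m p X).
apply: le_trans (uinorm_herm_mull _ c0 (herm_dilation_adj K) _); last first.
  exact: herm_dilation_opbound.
by rewrite mulmx_block !mulmx0 !mul0mx !addr0 !add0r.
Qed.

Lemma uinorm_mulr m n p (K : 'M[C]_(m, n)) (X : 'M[C]_(p, m)) c :
  0 <= c -> opbound c K -> N (X *m K) <= c * N X.
Proof.
move=> c0 Kc; rewrite -(uinorm_pad_ur p m (X *m K)) -(uinorm_pad p n X).
apply: le_trans (uinorm_herm_mulr _ c0 (herm_dilation_adj K) _); last first.
  exact: herm_dilation_opbound.
by rewrite mulmx_block !mulmx0 !mul0mx !addr0.
Qed.

(* A = W |A| with W a partial isometry and |A| = W^t* A Hermitian, so that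
   A^t* = W^t* A W^t*.  Since 0^-1 = 0, rv is a pseudo-inverse of r at 0. *)
Lemma uinorm_adj_le m n (A : 'M[C]_(m, n)) : N (A^t*) <= N A.
Proof.
have [F [FG FM FB F1 [Fadj FE Fquad]]] := gram_calculus A.
pose r (x : C) := sqrtC x; pose rv (x : C) := (sqrtC x)^-1.
have rR x : 0 <= x -> r x \is Num.real by apply: sqrtC_real.
have rvR x : 0 <= x -> rv x \is Num.real by move=> /rR; rewrite realV.
have rx x : rv x * r x * r x = r x.
  rewrite /rv -/(r x); have [->|rn0] := eqVneq (r x) 0; first by rewrite mulr0.
  by rewrite mulVf ?mul1r.
have rrx x : x = r x * r x by rewrite -expr2 sqrtCK.
have F0 : F (fun=> 0) = 0.
  by rewrite -(subrr (F (fun=> 1))) -FB; apply: FE => x _; rewrite subrr.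
pose W := A *m F rv.
have WA : W^t* *m A = F r.
  rewrite adjmxM Fadj // -mulmxA -FG FM; apply: FE => x x0.
  by rewrite {2}[x]rrx mulrA rx.
have Fz0 : F (fun x => x * (1 - rv x * r x)) = 0.
  rewrite -F0; apply: FE => x _.
  by rewrite mulrBr mulr1 {2}[x]rrx mulrC -mulrA mulrA mulrA rx -rrx subrr.
have AW : A = W *m F r.
  apply/eqP; rewrite -subr_eq0 -mulmxA FM; apply/eqP.
  have -> : A - A *m F (fun x => rv x * r x) = A *m F (fun x => 1 - rv x * r x).
    by rewrite FB F1 mulmxBr mulmx1.
  (* The squared norm of this vector contains the factor [F (fun x => x * (1 - rv x * r x))], zero
     by [Fz0]. *)
  have H0 (v : 'cV_n) : A *m F (fun x => 1 - rv x * r x) *m v = 0.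
    apply: sqnorm_eq0; rewrite sqnorm_mul adjmxM -!mulmxA [A^t* *m (_ *m _)]mulmxA.
    rewrite -FG [F id *m (_ *m _)]mulmxA FM.
    by rewrite Fz0 mul0mx !mulmx0 mxE.
  by apply/matrixP=> i j; have /colP/(_ i) := H0 (delta_mx j 0); rewrite -colE !mxE.
have W1 : opbound 1 W.
  move=> v; rewrite expr1n mul1r sqnorm_mul.
  rewrite adjmxM Fadj // -[F rv *m _ *m _]mulmxA [A^t* *m _]mulmxA -FG !FM.
  (* The function to bound is [(rv x * r x) ^+ 2], which is [0] where [r x = 0] and [1]
     elsewhere. *)
  apply: Fquad => x x0.
  have -> : rv x * (x * rv x) = (rv x * r x) ^+ 2 by rewrite {2}[x]rrx; ring.
  rewrite /rv -/(r x); have [->|rn0] := eqVneq (r x) 0.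
    by rewrite mulr0 expr0n ler01.
  by rewrite mulVf // expr1n.
rewrite {1}AW adjmxM Fadj // -WA.
apply: le_trans (uinorm_mulr _ ler01 _) _; first exact: opbound_adj.
rewrite mul1r; apply: le_trans (uinorm_mull _ ler01 _) _; first exact: opbound_adj.
by rewrite mul1r.
Qed.

Lemma uinorm_adj m n (A : 'M[C]_(m, n)) : N (A^t*) = N A.
Proof. by apply/le_anti; rewrite uinorm_adj_le -{1}[A]trmxCK uinorm_adj_le. Qed.

(** Both blocks enter the stack through isometric coordinate embeddings, which do not increase
    [N]. *)
Lemma uinorm_col_mx m n p (A : 'M[C]_(m, p)) (B : 'M[C]_(n, p)) :
  N (col_mx A B) <= N A + N B.
Proof.
have -> : col_mx A B = col_mx 1%:M 0 *m A + col_mx 0 1%:M *m B.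
  by rewrite !mul_col_mx !mul1mx !mul0mx add_col_mx addr0 add0r.
apply: le_trans (uinormD _ _) _; rewrite -[N A]mul1r -[N B]mul1r.
by apply: lerD; apply: (uinorm_mull _ ler01); apply: opbound_isom;
  rewrite adj_col_mx mul_row_col adjmx1 adjmx0 mulmx1 mul0mx ?addr0 ?add0r.
Qed.

End UnitarilyInvariantNorm.

(** * Characteristic polynomials of products and of unitary conjugates *)

Lemma char_poly_mulC (R : idomainType) n (A B : 'M[R]_n) :
  char_poly (A *m B) = char_poly (B *m A).
Proof.
pose a := map_mx polyC A; pose b := map_mx polyC B.
have abE (A1 B1 : 'M[R]_n) : char_poly_mx (A1 *m B1) =
    'X%:M - map_mx polyC A1 *m map_mx polyC B1 by rewrite /char_poly_mx map_mxM.
rewrite /char_poly !abE -/a -/b.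
(* [L] becomes block triangular in two ways. Comparing determinants gives the claim up to the factor
   ['X ^+ n], which cancels. *)
pose L : 'M[{poly R}]_(n + n) := block_mx 'X%:M a b 1%:M.
have E1 : L *m block_mx 1%:M (- a) 0 'X%:M = block_mx 'X%:M 0 b ('X%:M - b *m a).
  rewrite mulmx_block !mulmx1 !mulmx0 !addr0 !mulmxN !mul_scalar_mx mul_mx_scalar.
  by rewrite addNr scale1r [- _ + _]addrC.
have E2 : block_mx 1%:M (- a) 0 1%:M *m L = block_mx ('X%:M - a *m b) 0 b 1%:M.
  rewrite mulmx_block !mul1mx !mul0mx !mulmx1 !add0r mulNmx.
  by rewrite subrr.
have := congr1 determinant E1; have := congr1 determinant E2.
rewrite !det_mulmx !det_lblock !det_ublock !det1 !mul1r mulr1 => -> /eqP.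
rewrite mulrC (inj_eq (mulfI _)) => [/eqP //|].
by rewrite det_scalar expf_neq0 // polyX_eq0.
Qed.

Lemma char_poly_unitary_diag (C : numClosedFieldType) n (P : 'M[C]_n) (s : 'rV[C]_n) :
  P^t* *m P = 1%:M ->
  char_poly (P^t* *m diag_mx s *m P) = \prod_(i < n) ('X - (s 0 i)%:P).
Proof.
move=> PP.
pose p := map_mx polyC P; pose q := map_mx polyC (P^t*).
have qp : q *m p = 1%:M by rewrite -map_mxM PP map_mx1.
have -> : char_poly (P^t* *m diag_mx s *m P) = char_poly (diag_mx s).
  rewrite /char_poly /char_poly_mx.
  have -> : 'X%:M - map_mx polyC (P^t* *m diag_mx s *m P) =
     q *m ('X%:M - map_mx polyC (diag_mx s)) *m p.
    rewrite mulmxBr mulmxBl !map_mxM; congr (_ - _).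
    by rewrite scalar_mxC -mulmxA qp mulmx1.
  rewrite !det_mulmx mulrAC -det_mulmx qp det1 mul1r //.
rewrite char_poly_trig ?diag_mx_is_trig //.
by apply: eq_bigr => i _; rewrite mxE eqxx mulr1n.
Qed.

(** * Ordering and variational bounds of singular values *)

Section SingularValues.

Variable C : numClosedFieldType.

(** Both lists are the roots of one characteristic polynomial, whose linear factors are unique up to
    order. *)
Lemma spectral_diag_gram_adj n (A : 'M[C]_n) :
  perm_eq [seq spectral_diag (A^t* *m A) 0 i | i <- enum 'I_n]
          [seq spectral_diag (A *m A^t*) 0 i | i <- enum 'I_n].
Proof.
apply: prod_XsubC_eq; rewrite !big_map -enumT !big_enum /=.
have [_ P1 E1 _] := gram_spectral A.
have [_ P2 E2 _] := gram_spectral (A^t*); rewrite trmxCK in P2 E2.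
rewrite -(char_poly_unitary_diag _ P1) -(char_poly_unitary_diag _ P2).
by rewrite -E2 -E1 char_poly_mulC.
Qed.

Lemma sqnorm_spectral m n (A : 'M[C]_(m, n)) (v : 'cV_n) (G := A^t* *m A) :
  sqnorm (A *m v) =
  \sum_i spectral_diag G 0 i * `|(spectralmx G *m v) i 0| ^+ 2.
Proof.
have [PP PP' GE s_ge0] := gram_spectral A.
rewrite -/G in PP PP' GE s_ge0.
rewrite sqnorm_mul -/G.
set P := spectralmx G in PP PP' GE *; set s := spectral_diag G in GE s_ge0 *.
have -> : v^t* *m G *m v = (P *m v)^t* *m (diag_mx s *m (P *m v)).
  by rewrite {1}GE adjmxM !mulmxA.
rewrite mxE; apply: eq_bigr => i _.
by rewrite mul_diag_mx !mxE mulrCA -normCKC.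
Qed.

Lemma sqnorm_spectralmx m n (A : 'M[C]_(m, n)) (v : 'cV_n) :
  sqnorm v = \sum_i `|(spectralmx (A^t* *m A) *m v) i 0| ^+ 2.
Proof.
by have [_ PP' _ _] := gram_spectral A; rewrite -sqnormE sqnorm_isom.
Qed.

Variables (m n : nat) (A : 'M[C]_(m, n)).

Lemma size_gram_eigs : size (gram_eigs A) = n.
Proof. by rewrite size_sort size_map size_enum_ord. Qed.

Lemma mem_gram_eigs x :
  reflect (exists i, x = spectral_diag (A^t* *m A) 0 i) (x \in gram_eigs A).
Proof.
rewrite mem_sort; apply: (iffP mapP) => [[i _ ->]|[i ->]]; first by exists i.
by exists i => //; rewrite mem_enum.
Qed.

Lemma gram_eigs_ge0 x : x \in gram_eigs A -> 0 <= x.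
Proof. by case/mem_gram_eigs=> i ->; have [_ _ _] := gram_spectral A. Qed.

Lemma nth_gram_eigs_ge0 i : 0 <= nth 0 (gram_eigs A) i.
Proof.
have [lt_i|ge_i] := ltnP i (size (gram_eigs A)); last by rewrite nth_default.
by rewrite gram_eigs_ge0 ?mem_nth.
Qed.

(** The order on [C] is partial, so [sort] is known to sort only because the eigenvalues are
    real. *)
Lemma gram_eigs_sorted i j : (i <= j < n)%N ->
  nth 0 (gram_eigs A) j <= nth 0 (gram_eigs A) i.
Proof.
case/andP=> le_ij lt_jn; set e := gram_eigs A.
have se : sorted (fun x y : C => y <= x) e.
  rewrite /e /gram_eigs; apply: (@sort_sorted_in _ Num.real) => [x y xR yR|].
    by rewrite orbC; apply: real_leVge.
  apply/allP=> x xs; apply: ger0_real; apply: gram_eigs_ge0.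
  by rewrite mem_sort.
apply: (sorted_leq_nth _ _ 0 se) => //; rewrite ?inE ?size_gram_eigs //.
- by move=> y x z yx zy; apply: le_trans zy yx.
- exact: leq_ltn_trans lt_jn.
Qed.

Lemma sing_valE i : (i < n)%N -> sing_val A i = sqrtC (nth 0 (gram_eigs A) i).
Proof. by move=> ltin; rewrite /sing_val (nth_map 0) ?size_gram_eigs. Qed.

Lemma sing_val_ge0 i : 0 <= sing_val A i.
Proof.
have [ltin|leni] := ltnP i n; first by rewrite sing_valE // sqrtC_ge0 nth_gram_eigs_ge0.
by rewrite /sing_val nth_default // size_map size_gram_eigs.
Qed.

Lemma spnorm_ge0 : 0 <= spnorm A.
Proof. exact: sing_val_ge0. Qed.

Lemma opbound_spnorm : opbound (spnorm A) A.
Proof.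
move=> v; rewrite sqnorm_spectral (sqnorm_spectralmx A v) mulr_sumr ler_sum // => i _.
rewrite ler_wpM2r ?exprn_ge0 //.
have n0 : (0 < n)%N by case: (n) i => [[]|].
rewrite /spnorm sing_valE // sqrtCK.
have /(nthP 0)[j + <-] : spectral_diag (A^t* *m A) 0 i \in gram_eigs A.
  by apply/mem_gram_eigs; exists i.
by rewrite size_gram_eigs => ltjn; rewrite gram_eigs_sorted.
Qed.

(* If sing_val A j < c, at most j eigenvalues of A^t* A are >= c^2; some y <> 0 in
   C^k has V y orthogonal to all the corresponding eigenvectors. *)
Lemma sing_val_lower_bound k (V : 'M[C]_(n, k)) (c : C) j :
  0 <= c -> (j < k)%N -> V^t* *m V = 1%:M ->
  (forall y : 'cV_k, c ^+ 2 * sqnorm y <= sqnorm (A *m (V *m y))) ->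
  c <= sing_val A j.
Proof.
move=> c0 ltjk VV Hc; rewrite real_leNgt ?ger0_real ?sing_val_ge0 //.
apply/negP=> lt_c; set s := spectral_diag (A^t* *m A).
have [_ _ _ s_ge0] := gram_spectral A; rewrite -/s in s_ge0.
have c2_ge0 : 0 <= c ^+ 2 by rewrite exprn_ge0.
pose J := [set i | c ^+ 2 <= s 0 i].
have cardJ : (#|J| <= j)%N.
  have -> : #|J| = count (fun x => c ^+ 2 <= x) (gram_eigs A).
    rewrite (seq.permP (permEl (perm_sort _ _))) count_map cardsE cardE size_filter.
    by rewrite enumT.
  (* From position [j] on, the sorted eigenvalues are below [c ^+ 2], so only the first [j] can be
     counted. *)
  rewrite -(cat_take_drop j (gram_eigs A)) count_cat.
  have -> : count (fun x => c ^+ 2 <= x) (drop j (gram_eigs A)) = 0%N.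
    apply/eqP; rewrite -leqn0 leqNgt -has_count; apply/hasPn=> x /(nthP 0)[i].
    rewrite size_drop nth_drop size_gram_eigs => ltin <-.
    have ltn_ji : (j + i < n)%N by rewrite -ltn_subRL.
    rewrite -real_ltNge ?ger0_real ?nth_gram_eigs_ge0 //.
    apply: (le_lt_trans (gram_eigs_sorted (_ : j <= j + i < n)%N)).
      by rewrite leq_addr.
    rewrite -[ltLHS]sqrtCK -sing_valE ?(leq_ltn_trans _ ltn_ji) ?leq_addr //.
    by rewrite ltr_pXn2r ?nnegrE ?sing_val_ge0.
  rewrite addn0 (leq_trans (count_size _ _)) // size_take; case: ltnP => // _.
pose E : 'M[C]_(#|J|, n) := \matrix_(a, b) (enum_val a == b)%:R.
set P := spectralmx (A^t* *m A).
pose B := E *m P *m V.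
(* [B] has at most [j < k] rows and [k] columns, so some nonzero vector is annihilated by it. *)
have : kermx B^T != 0.
  rewrite kermx_eq0 /row_free mxrank_tr neq_ltn.
  by rewrite (leq_ltn_trans (rank_leq_row _)) // (leq_ltn_trans cardJ).
case/rowV0Pn=> y /sub_kermxP yB yn0.
have By : B *m y^T = 0 by rewrite -[B]trmxK -trmx_mul yB trmx0.
pose w := P *m (V *m y^T).
have wJ i : i \in J -> w i 0 = 0.
  move=> iJ; have /colP/(_ (enum_rank_in iJ i)) := By.
  rewrite /B -!mulmxA -/w mxE [RHS]mxE (bigD1 i) //= mxE enum_rankK_in // eqxx mul1r.
  by rewrite big1 ?addr0 // => b /negPf bi; rewrite mxE enum_rankK_in // eq_sym bi mul0r.
have w_term i : 0 <= (c ^+ 2 - s 0 i) * `|w i 0| ^+ 2.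
  have [/wJ->|] := boolP (i \in J); first by rewrite normr0 expr0n mulr0.
  rewrite inE -real_ltNge ?ger0_real // => /ltW lt_s.
  by rewrite mulr_ge0 ?exprn_ge0 // subr_ge0.
(* [Hc] makes the sum of the nonnegative terms [w_term] at most [0], so all vanish. Outside [J] the
   first factor is positive, whence [w = 0] and [y = 0]. *)
have := Hc y^T; rewrite sqnorm_spectral -(sqnorm_isom y^T VV) (sqnorm_spectralmx A).
rewrite -/s -/P -/w mulr_sumr -subr_le0 -sumrB => sum_le0.
have : \sum_i (c ^+ 2 - s 0 i) * `|w i 0| ^+ 2 = 0.
  apply/le_anti; rewrite sumr_ge0 ?andbT //.
  by apply: le_trans sum_le0; rewrite ler_sum // => i _; rewrite mulrBl.
move/psumr_eq0P => w0; suff w_eq0 : w = 0.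
  have : sqnorm y^T = 0.
    rewrite -(sqnorm_isom _ VV) (sqnorm_spectralmx A) -/P -/w w_eq0.
    by rewrite big1 // => i _; rewrite mxE normr0 expr0n.
  by move/sqnorm_eq0/eqP; rewrite trmx_eq0 (negPf yn0).
apply/colP=> i; rewrite [RHS]mxE; have [/wJ //|] := boolP (i \in J).
rewrite inE -real_ltNge ?ger0_real // => lt_s.
have /eqP := w0 (fun i _ => w_term i) i isT.
by rewrite mulf_eq0 subr_eq0 gt_eqF //= expf_eq0 /= normr_eq0 => /eqP.
Qed.

End SingularValues.

(** * Smallest singular value, vector norms and canonical angles *)

Section SminAndVectorNorms.

Variable C : numClosedFieldType.

Lemma smin_sing_val p (M : 'M[C]_p) : smin M = sing_val M p.-1.
Proof. by rewrite /smin /sing_val -nth_last size_map size_gram_eigs. Qed.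

Lemma smin_ge0 p (M : 'M[C]_p) : 0 <= smin M.
Proof. by rewrite smin_sing_val sing_val_ge0. Qed.

Lemma smin_lower_bound p (M : 'M[C]_p) (v : 'cV_p) :
  smin M ^+ 2 * sqnorm v <= sqnorm (M *m v).
Proof.
rewrite sqnorm_spectral (sqnorm_spectralmx M v) mulr_sumr ler_sum // => i _.
rewrite ler_wpM2r ?exprn_ge0 //.
have ltpp : (p.-1 < p)%N by case: (p) i => [[]|].
rewrite smin_sing_val sing_valE // sqrtCK.
have /(nthP 0)[j + <-] : spectral_diag (M^t* *m M) 0 i \in gram_eigs M.
  by apply/mem_gram_eigs; exists i.
rewrite size_gram_eigs => ltjp; rewrite gram_eigs_sorted // ltpp andbT.
by rewrite -ltnS prednK // (leq_trans _ ltjp).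
Qed.

(** This is the variational bound at the last index, with the identity as [V]. *)
Lemma smin_diag_ge p (d : 'rV[C]_p) (c : C) :
  (0 < p)%N -> 0 <= c -> (forall i, c <= d 0 i) -> c <= smin (diag_mx d).
Proof.
move=> p0 c0 cd; rewrite smin_sing_val.
apply: (@sing_val_lower_bound _ _ _ _ _ 1%:M) => //.
- by rewrite ltn_predL.
- by rewrite adjmx1 mulmx1.
move=> y; rewrite mul1mx !sqnormE mulr_sumr ler_sum // => i _.
rewrite mul_diag_mx mxE normrM exprMn ler_wpM2r ?exprn_ge0 //.
by rewrite lerXn2r ?nnegrE // ger0_norm // (le_trans c0).
Qed.

Lemma norm_entry_le_spnorm p q (M : 'M[C]_(p, q)) i j : `|M i j| <= spnorm M.
Proof.
rewrite -(@ler_pXn2r _ 2) ?nnegrE ?spnorm_ge0 //.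
have := opbound_spnorm M (delta_mx j 0).
have -> : sqnorm (delta_mx j 0 : 'cV[C]_q) = 1.
  rewrite sqnormE (bigD1 j) //= big1 ?addr0 ?mxE ?eqxx ?normr1 ?expr1n //.
  by move=> k /negPf kj; rewrite mxE kj normr0 expr0n.
rewrite mulr1 -colE sqnormE; apply: le_trans.
by rewrite (bigD1 i) //= mxE lerDl sumr_ge0 // => k _; rewrite exprn_ge0.
Qed.

Lemma vnorm_ge0 q (r : 'rV[C]_q) : 0 <= vnorm r.
Proof. by rewrite sqrtC_ge0 sumr_ge0 // => i _; rewrite exprn_ge0. Qed.

Lemma rownorm_ord p q (M : 'M[C]_(p, q)) (i : 'I_p) : rownorm M i = vnorm (row i M).
Proof. by rewrite /rownorm valK. Qed.

Lemma rownorm_ge0 p q (M : 'M[C]_(p, q)) i : 0 <= rownorm M i.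
Proof. by rewrite /rownorm; case: insub => // i'; apply: vnorm_ge0. Qed.

Lemma opbound_col p (u : 'cV[C]_p) : opbound (vnorm u^T) u.
Proof.
move=> x; rewrite sqrtCK !sqnormE big_ord1 mulr_suml ler_sum // => i _.
by rewrite !mxE big_ord1 normrM exprMn.
Qed.

(** This is the Cauchy-Schwarz inequality, obtained as the adjoint of the case of a column. *)
Lemma opbound_row q (r : 'rV[C]_q) : opbound (vnorm r) r.
Proof.
rewrite -{2}[r]trmxCK; apply: opbound_adj (vnorm_ge0 r) _.
have -> : vnorm r = vnorm (r^t*)^T; last exact: opbound_col.
by congr sqrtC; apply: eq_bigr => j _; rewrite !mxE norm_conjC.
Qed.

Variables (N : forall m n, 'M[C]_(m, n) -> C).
Hypothesis Ninv : unitarily_invariant_norm N.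

(** [M] is invertible with inverse bounded by [(smin M)^-1]; apply that bound to
    [X = (X *m M) *m invmx M]. *)
Lemma uinorm_smin m p (M : 'M[C]_p) (X : 'M[C]_(m, p)) :
  0 < smin M -> smin M * N X <= N (X *m M).
Proof.
move=> s0; have MU : M \in unitmx.
  rewrite -unitmx_tr -row_free_unit; apply: inj_row_free => v.
  move/(congr1 trmx); rewrite trmx_mul trmxK trmx0 => Mv0.
  have := smin_lower_bound M v^T; rewrite Mv0.
  rewrite [leRHS](_ : _ = 0) ?pmulr_rle0 ?exprn_gt0 // => [sv|]; last first.
    by rewrite /sqnorm mulmx0 mxE.
  apply: trmx_inj; rewrite trmx0; apply: sqnorm_eq0; apply/le_anti.
  by rewrite sv sqnorm_ge0.
have Mb : opbound (smin M)^-1 (invmx M).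
  move=> v; rewrite exprVn mulrC ler_pdivlMr ?exprn_gt0 // mulrC.
  by apply: le_trans (smin_lower_bound _ _) _; rewrite mulKVmx.
rewrite -{1}[X](mulmxK MU) mulrC -ler_pdivlMr // mulrC.
by apply: uinorm_mulr => //; rewrite invr_ge0 ltW.
Qed.

(* Y is Z up to a unitary change of columns, chosen so that Y^t* Y is the square
   of the diagonal matrix sin_angle X Xh; this uses that M^t* M and M M^t* have
   the same eigenvalues, listed in different orders. *)
Lemma uinorm_sin_angle m p q (X Xh : 'M[C]_(m, p)) (Xp : 'M[C]_(m, q)) :
  X^t* *m X = 1%:M -> Xh *m Xh^t* + Xp *m Xp^t* = 1%:M ->
  N (sin_angle X Xh) <= N (Xp^t* *m X).
Proof.
move=> XX XhXp; pose M := X^t* *m Xh; pose Z := Xp^t* *m X.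
have ZZ : Z^t* *m Z = 1%:M - M *m M^t*.
  have -> : Z^t* *m Z = X^t* *m (Xp *m Xp^t*) *m X.
    by rewrite /Z adjmxM trmxCK !mulmxA.
  have -> : M *m M^t* = X^t* *m (Xh *m Xh^t*) *m X.
    by rewrite /M adjmxM trmxCK !mulmxA.
  have -> : Xp *m Xp^t* = 1%:M - Xh *m Xh^t* by rewrite -XhXp addrC addKr.
  by rewrite mulmxBr mulmx1 mulmxBl XX.
have [PP PP' GE s_ge0] := gram_spectral (M^t*); rewrite trmxCK in PP PP' GE s_ge0.
set P := spectralmx _ in PP PP' GE; set s := spectral_diag _ in GE s_ge0.
have [sig eE] : exists sig : 'S_p, forall i : 'I_p,
    nth 0 (gram_eigs M) i = s 0 (sig i).
  have /tuple_permP[sig eE] : perm_eq (gram_eigs M) [tuple s 0 i | i < p].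
    by rewrite (permPl (permEl (perm_sort _ _))) spectral_diag_gram_adj.
  exists sig => i; rewrite eE (nth_map i) ?size_enum_ord // nth_ord_enum.
  by rewrite tnth_mktuple.
pose e i := nth 0 (gram_eigs M) i.
pose S : 'M[C]_p := \matrix_(a, i) (a == sig i)%:R.
have SS : S^t* *m S = 1%:M.
  apply/matrixP=> i j; rewrite mxE (bigD1 (sig i)) //= big1 => [|a /negPf ai].
    by rewrite !mxE eqxx conjC1 mul1r addr0 (inj_eq perm_inj).
  by rewrite !mxE ai conjC0 mul0r.
have sS : diag_mx s *m S = S *m diag_mx (\row_(i < p) e i).
  apply/matrixP=> a i; rewrite mul_diag_mx mul_mx_diag !mxE /e eE mulrC.
  by case: eqP => [->|]; rewrite ?mul0r.
pose T := P^t* *m S; pose Y := Z *m T.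
have TT : T^t* *m T = 1%:M.
  by rewrite adjmxM trmxCK mulmxA -[_ *m P *m _]mulmxA PP mulmx1.
have YY : Y^t* *m Y = diag_mx (\row_(i < p) (1 - e i)).
  rewrite adjmxM mulmxA -[_ *m _ *m Z]mulmxA ZZ mulmxBr mulmx1 mulmxBl TT.
  have -> : T^t* *m (M *m M^t*) *m T = diag_mx (\row_(i < p) e i).
    rewrite GE /T adjmxM trmxCK !mulmxA -[_ *m P *m P^t*]mulmxA PP mulmx1.
    rewrite -[_ *m P *m P^t*]mulmxA PP mulmx1 -[_ *m S]mulmxA sS mulmxA SS.
    by rewrite mul1mx.
  rewrite -diag_const_mx -linearB; congr diag_mx.
  by apply/rowP=> i; rewrite !mxE.
have NY : N Y <= N Z.
  by apply: le_trans (uinorm_mulr Ninv _ ler01 (opbound_isom TT)) _; rewrite mul1r.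
clearbody Y.
have e_le1 (i : 'I_p) : 0 <= 1 - e i.
  have /matrixP/(_ i i) := YY; rewrite [RHS]mxE eqxx mulr1n [RHS]mxE => <-.
  by rewrite mxE sumr_ge0 // => j _; rewrite 2!mxE mulrC mul_conjC_ge0.
pose d (i : 'I_p) := sqrtC (1 - e i).
have dR i : d i \is Num.real by apply: sqrtC_real.
have DE : sin_angle X Xh = diag_mx (\row_(i < p) d i).
  congr diag_mx; apply/rowP=> i; rewrite !mxE /d -/M sing_valE // sqrtCK.
  by [].
(* With [D] the sine matrix, [K] is the pseudo-inverse of [D] times [Y^t*], so [K *m Y = D]; the
   convention [0^-1 = 0] covers zero sines. *)
pose K := diag_mx (\row_(i < p) (d i)^-1) *m Y^t*.
have KY : K *m Y = sin_angle X Xh.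
  rewrite /K -mulmxA YY mulmx_diag DE; congr diag_mx; apply/rowP=> i.
  rewrite !mxE -[1 - e i]sqrtCK -/(d i) expr2.
  have [->|dn0] := eqVneq (d i) 0; first by rewrite !mulr0.
  by rewrite mulKf.
(* [K *m K^t*] is diagonal with entries [0] and [1]. *)
have Kb : opbound 1 (K^t*).
  move=> v; rewrite sqnorm_mul trmxCK /K adjmxM trmxCK adj_diag_mx_real; last first.
    by move=> i; rewrite mxE realV.
  rewrite [_ *m Y^t* *m _]mulmxA -[_ *m Y^t* *m Y]mulmxA YY !mulmx_diag expr1n mul1r.
  rewrite -mulmxA mxE sqnormE ler_sum // => i _.
  rewrite mul_diag_mx !mxE mulrCA -normCKC ler_piMl ?exprn_ge0 //.
  rewrite -[1 - e i]sqrtCK -/(d i).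
  have [->|dn0] := eqVneq (d i) 0; first by rewrite invr0 mulr0 ler01.
  by rewrite expr2 mulKf // divff.
rewrite -KY -[K]trmxCK; apply: le_trans (uinorm_mull Ninv _ ler01 (opbound_adj ler01 Kb)) _.
by rewrite mul1r.
Qed.

End SminAndVectorNorms.

(** * Scalar inequalities *)

Section ScalarInequalities.

Variable C : numClosedFieldType.
Implicit Types x y z s b e : C.

Lemma ge0_le_maxl x y : 0 <= x -> 0 <= y -> x <= Num.max x y.
Proof. by move=> x0 y0; rewrite /Num.max; case: ifP => // /ltW. Qed.

(** [Num.max x y] tests [x < y]; nonnegativity makes [x] and [y] comparable, so a failed test means
    [y <= x]. *)
Lemma ge0_le_maxr x y : 0 <= x -> 0 <= y -> y <= Num.max x y.
Proof.
move=> x0 y0; rewrite /Num.max; case: ifP => // xy.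
by rewrite real_leNgt ?ger0_real ?xy.
Qed.

Lemma max_le_both x y z : x <= z -> y <= z -> Num.max x y <= z.
Proof. by move=> xz yz; rewrite /Num.max; case: ifP. Qed.

(** Replacing the unknown on the right by the maximum turns the inequality for the larger unknown
    into [(s - b) * max <= e]. *)
Lemma coupled_max_le x y s b e : 0 <= x -> 0 <= y -> 0 <= b -> b < s ->
  s * x <= b * y + e -> s * y <= b * x + e -> Num.max x y <= e / (s - b).
Proof.
move=> x0 y0 b0 bs xy yx; rewrite ler_pdivlMr ?subr_gt0 // mulrBr lerBlDl.
rewrite mulrC [_ * b]mulrC.
have [xz yz] := (ge0_le_maxl x0 y0, ge0_le_maxr x0 y0).
rewrite {1}/Num.max; case: ifP => _.
  by apply: le_trans yx _; rewrite lerD2r ler_wpM2l.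
by apply: le_trans xy _; rewrite lerD2r ler_wpM2l.
Qed.

(** Common end of the three estimates: the part [gam * M] of the third-row residual is absorbed on
    the left, which lowers [g] to [g - gam], and [beta] accounts for the second blocks. *)
Lemma coupled_theta_le tU tV u2 v2 u3 v3 s a g e beta gam
    (M := Num.max u3 v3) : 0 <= u3 -> 0 <= v3 -> 0 <= a -> 0 <= beta ->
  g <= s - a -> gam < g -> 0 < g ->
  s * u3 <= a * v3 + (e + gam * M) -> s * v3 <= a * u3 + (e + gam * M) ->
  u2 <= beta * M -> v2 <= beta * M -> tU <= u2 + u3 -> tV <= v2 + v3 ->
  Num.max tU tV <= e / (g - gam) * (1 + beta).
Proof.
move=> u0 v0 a0 b0 gs gam_g g0 Hu Hv u2M v2M tUle tVle.
have as_ : a < s by rewrite -subr_gt0 (lt_le_trans g0).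
have := coupled_max_le u0 v0 a0 as_ Hu Hv; rewrite -/M ler_pdivlMr ?subr_gt0 // => HM.
have M0 : 0 <= M by rewrite (le_trans u0) ?ge0_le_maxl.
have Me : M <= e / (g - gam).
  rewrite ler_pdivlMr ?subr_gt0 // mulrBr lerBlDr [M * gam]mulrC.
  by apply: le_trans HM; rewrite ler_wpM2l.
have b1 : 0 <= 1 + beta by rewrite addr_ge0.
apply: le_trans (ler_wpM2r b1 Me); rewrite mulrDr mulr1 addrC [M * beta]mulrC.
apply: max_le_both; [apply: le_trans tUle _|apply: le_trans tVle _];
  by rewrite lerD ?ge0_le_maxl ?ge0_le_maxr.
Qed.

(** Passes from the row count of one block to the larger of the two counts. *)
Lemma ler_sum_ord_widen p q (F : nat -> C) :
  (p <= q)%N -> (forall i, 0 <= F i) -> \sum_(i < p) F i <= \sum_(i < q) F i.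
Proof.
move=> pq F0; rewrite (big_ord_widen _ F pq) [leRHS](bigID (fun i : 'I_q => (i < p)%N)) /=.
by rewrite lerDl sumr_ge0.
Qed.

End ScalarInequalities.

(** * Block equations and row-wise bounds *)

Lemma block_rows (C : numClosedFieldType) m n k p1 p2 p3 q1 q2 q3
    (A : 'M[C]_(m, n)) (U1 : 'M[C]_(m, p1)) (U2 : 'M[C]_(m, p2)) (U3 : 'M[C]_(m, p3))
    (V1 : 'M[C]_(n, q1)) (V2 : 'M[C]_(n, q2)) (V3 : 'M[C]_(n, q3))
    (D1 : 'M[C]_(p1, q1)) (D2 : 'M[C]_(p2, q2)) (R1 : 'M[C]_(p1, q3)) (R2 : 'M[C]_(p2, q3))
    (S1 : 'M[C]_(p3, q1)) (S2 : 'M[C]_(p3, q2)) (A3 : 'M[C]_(p3, q3))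
    (X : 'M[C]_(m, k)) (Y : 'M[C]_(n, k)) (G : 'M[C]_k) :
  row_mx (row_mx V1 V2) V3 \is unitarymx ->
  (row_mx (row_mx U1 U2) U3)^t* *m A *m row_mx (row_mx V1 V2) V3
    = block_mx (block_mx D1 0 0 D2) (col_mx R1 R2) (row_mx S1 S2) A3 ->
  A *m Y = X *m G ->
  D2 *m (V2^t* *m Y) + R2 *m (V3^t* *m Y) = U2^t* *m X *m G /\
  S1 *m (V1^t* *m Y) + S2 *m (V2^t* *m Y) + A3 *m (V3^t* *m Y) = U3^t* *m X *m G.
Proof.
move=> VU blk AY.
(* Insert [V *m V^t* = 1] between [A] and [Y]; the second and third block rows are then read off. *)
have UAY : (row_mx (row_mx U1 U2) U3)^t* *m A *m Y =
  block_mx (block_mx D1 0 0 D2) (col_mx R1 R2) (row_mx S1 S2) A3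
    *m ((row_mx (row_mx V1 V2) V3)^t* *m Y).
  by rewrite -blk mulmxA mulmxtVK.
move: UAY; rewrite -[_ *m A *m Y]mulmxA AY [_ *m (X *m G)]mulmxA !adj_row_mx !mul_col_mx.
rewrite !mul_row_col mul_block_col mul_col_mx add_col_mx.
by case/eq_col_mx=> /eq_col_mx[_ ->] ->; rewrite mul0mx add0r.
Qed.

Section ResidualBounds.

Variables (C : numClosedFieldType) (N : forall m n, 'M[C]_(m, n) -> C).
Hypothesis Ninv : unitarily_invariant_norm N.

(** The default [0] lets two blocks with different numbers of rows be compared at every index. *)
Definition rowval p q (X : 'M[C]_(p, q)) (i : nat) : C :=
  if insub i is Some i' then N (row i' X) else 0.

Lemma rowval_ge0 p q (X : 'M[C]_(p, q)) i : 0 <= rowval X i.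
Proof. by rewrite /rowval; case: insub => // i'; apply: uinorm_ge0. Qed.

(** The product is a sum of columns times rows, and a column acts with its Euclidean norm as
    bound. *)
Lemma uinorm_mul_rows m p k (K : 'M[C]_(m, p)) (X : 'M[C]_(p, k)) :
  N (K *m X) <= \sum_(i < p) colnorm K i * rowval X i.
Proof.
have -> : K *m X = \sum_(i < p) col i K *m row i X.
  apply/matrixP=> a b; rewrite mxE summxE; apply: eq_bigr => i _.
  by rewrite mxE big_ord1 !mxE.
apply: le_trans (uinorm_sum Ninv _ _) _; apply: ler_sum => i _.
rewrite /colnorm rownorm_ord /rowval valK -tr_col.
by apply: uinorm_mull (opbound_col _); rewrite ?vnorm_ge0.
Qed.

Lemma uinorm_le_rows p k (X : 'M[C]_(p, k)) : N X <= \sum_(i < p) rowval X i.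
Proof.
rewrite -{1}[X]mul1mx; apply: le_trans (uinorm_mul_rows _ _) _.
apply: ler_sum => i _; rewrite ler_piMl ?rowval_ge0 // /colnorm rownorm_ord /vnorm.
rewrite (bigD1 i) //= big1 => [|j /negPf ji]; last first.
  by rewrite !mxE ji normr0 expr0n.
by rewrite !mxE eqxx normr1 expr1n addr0 sqrtC1.
Qed.

(** As [D] is rectangular diagonal, row [i] of the equation involves [Y] only through [g i] times
    its own row [i]. *)
Lemma rowval_bound p q r k (D : 'M[C]_(p, q)) (R : 'M[C]_(p, r)) (g : nat -> C)
    (X : 'M[C]_(p, k)) (Y : 'M[C]_(q, k)) (W : 'M[C]_(r, k)) (G : 'M[C]_k) i :
  (forall i j, D i j = if (i : nat) == j then g i else 0) ->
  (forall i, 0 <= g i) -> 0 < smin G ->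
  D *m Y + R *m W = X *m G ->
  smin G * rowval X i <= g i * rowval Y i + rownorm R i * N W.
Proof.
move=> Dg g0 sG E; rewrite {1}/rowval; case: insubP => [a _ <-|_]; last first.
  by rewrite mulr0 addr_ge0 ?mulr_ge0 ?rowval_ge0 ?rownorm_ge0 ?uinorm_ge0.
apply: le_trans (uinorm_smin Ninv _ sG) _.
rewrite -row_mul -E linearD /=; apply: le_trans (uinormD Ninv _ _) _.
apply: lerD; last first.
  rewrite rownorm_ord row_mul; apply: uinorm_mull (opbound_row _) => //.
  exact: vnorm_ge0.
rewrite /rowval; case: insubP => [b _ ba|aq].
  have -> : row a (D *m Y) = g a *: row b Y.
    apply/rowP=> c; rewrite !mxE (bigD1 b) //= big1 => [|j jb].
      by rewrite Dg -ba eqxx addr0.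
    rewrite Dg -ba; case: eqP => [/val_inj bj|]; last by rewrite mul0r.
    by rewrite bj eqxx in jb.
  by rewrite uinormZ // ger0_norm.
(* Here [a] exceeds the row indices of [Y]: row [a] of [D] is zero, in accordance with the default
   of [rowval]. *)
have -> : row a (D *m Y) = 0.
  apply/rowP=> c; rewrite !mxE big1 // => j _; rewrite Dg.
  case: eqP => [aj|]; last by rewrite mul0r.
  by rewrite aj ltn_ord in aq.
by rewrite uinorm0 // mulr0.
Qed.

End ResidualBounds.

(** * Submatrices and interlacing *)

Lemma opbound_usub (C : numClosedFieldType) m n p c (A : 'M[C]_(m, p)) (B : 'M[C]_(n, p)) :
  opbound c (col_mx A B) -> opbound c A.
Proof.
move=> ABc v; apply: le_trans (ABc v).
by rewrite mul_col_mx sqnorm_col_mx lerDl sqnorm_ge0.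
Qed.

Lemma rownorm_adj (C : numClosedFieldType) p q (M : 'M[C]_(p, q)) i :
  rownorm (M^t*) i = colnorm M i.
Proof.
rewrite /colnorm /rownorm; case: insub => // a; congr sqrtC.
by apply: eq_bigr => j _; rewrite !mxE norm_conjC.
Qed.

(** In the basis [U], [A *m V1] has blocks [D1], [0], [S1], so [A] stretches the range of [V1], of
    dimension [p1], by at least [smin D1]. *)
Lemma smin_block_le_sing_val (C : numClosedFieldType) m n p1 p2 p3 q2 q3
    (A : 'M[C]_(m, n)) (U : 'M[C]_(m, p1 + p2 + p3))
    (V1 : 'M[C]_(n, p1)) (V2 : 'M[C]_(n, q2)) (V3 : 'M[C]_(n, q3))
    (D1 : 'M[C]_p1) (D2 : 'M[C]_(p2, q2)) (R : 'M[C]_(p1 + p2, q3))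
    (S1 : 'M[C]_(p3, p1)) (S2 : 'M[C]_(p3, q2)) (A3 : 'M[C]_(p3, q3)) j :
  U \is unitarymx -> (row_mx (row_mx V1 V2) V3)^t* \is unitarymx ->
  U^t* *m A *m row_mx (row_mx V1 V2) V3
    = block_mx (block_mx D1 0 0 D2) R (row_mx S1 S2) A3 ->
  (j < p1)%N -> smin D1 <= sing_val A j.
Proof.
move=> UU VU blk ltj.
pose J : 'M[C]_(p1 + q2 + q3, p1) := col_mx (col_mx 1%:M 0) 0.
have VJ : row_mx (row_mx V1 V2) V3 *m J = V1.
  by rewrite !mul_row_col !mulmx0 mulmx1 !addr0.
have JJ : J^t* *m J = 1%:M.
  rewrite !adj_col_mx !mul_row_col adjmx1 !adjmx0 mulmx1.
  by rewrite !mul0mx !addr0.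
have UAV : U^t* *m (A *m V1) = col_mx (col_mx D1 0) S1.
  rewrite -VJ !mulmxA blk /J !mul_block_col mul_row_col.
  by rewrite !mulmx0 !mulmx1 !addr0.
apply: (@sing_val_lower_bound _ _ _ _ _ V1); rewrite ?smin_ge0 //.
  by rewrite -VJ adjmxM mulmxA -[_ *m _ *m row_mx _ _]mulmxA unitarymx_adj1 // mulmx1.
move=> y; have U1 : U^t*^t* *m U^t* = 1%:M by rewrite trmxCK; apply/unitarymxP.
rewrite -(sqnorm_isom (A *m (V1 *m y)) U1) mulmxA.
rewrite [_ *m A *m _]mulmxA -[_ *m A *m V1]mulmxA UAV !mul_col_mx !sqnorm_col_mx.
by apply: le_trans (smin_lower_bound _ _) _; rewrite -addrA lerDl addr_ge0 ?sqnorm_ge0.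
Qed.

(** * Assembly of the three bounds on the canonical angles *)

Unset Implicit Arguments.
Unset Strict Implicit.

Theorem theorem6p1 (C : numClosedFieldType) (m n km kn k1 : nat)
  (A : 'M[C]_(m, n))
  (U1h : 'M[C]_(m, k1)) (U2h : 'M[C]_(m, km - k1)) (U3h : 'M[C]_(m, m - km))
  (V1h : 'M[C]_(n, k1)) (V2h : 'M[C]_(n, kn - k1)) (V3h : 'M[C]_(n, n - kn))
  (Sh1 : 'M[C]_k1) (Sh2 : 'M[C]_(km - k1, kn - k1))
  (R1 : 'M[C]_(k1, n - kn)) (R2 : 'M[C]_(km - k1, n - kn))
  (S1 : 'M[C]_(m - km, k1)) (S2 : 'M[C]_(m - km, kn - k1))
  (A3 : 'M[C]_(m - km, n - kn))
  (sh : nat -> C)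
  (U1 : 'M[C]_(m, k1)) (V1 : 'M[C]_(n, k1)) :
  (n <= m)%N -> (1 <= k1)%N -> (k1 < minn km kn)%N -> (km <= m)%N -> (kn <= n)%N ->
  (* [Uh1 Uh2 Uh3] and [Vh1 Vh2 Vh3] are square unitary *)
  row_mx (row_mx U1h U2h) U3h \is unitarymx ->
  (row_mx (row_mx U1h U2h) U3h) ^t* \is unitarymx ->
  row_mx (row_mx V1h V2h) V3h \is unitarymx ->
  (row_mx (row_mx V1h V2h) V3h) ^t* \is unitarymx ->
  (* the block form *)
  (row_mx (row_mx U1h U2h) U3h) ^t* *m A *m row_mx (row_mx V1h V2h) V3h
    = block_mx (block_mx Sh1 0 0 Sh2) (col_mx R1 R2) (row_mx S1 S2) A3 ->
  (* diag(Sh1, Sh2) is the rectangular diagonal matrix with real diagonal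
     entries sh_0 = sigmahat_1, ..., sh_(k-1) = sigmahat_k, k = min(km, kn) *)
  block_mx Sh1 0 0 Sh2
    = \matrix_(i, j) (if (i : nat) == (j : nat) then sh i else 0) ->
  (forall i, (i < minn km kn)%N -> 0 <= sh i) ->
  (* (Sigma1, U1, V1): the k1 leading singular triplets of A *)
  let Sig1 := diag_mx (\row_(i < k1) sing_val A i) in
  U1 ^t* \is unitarymx -> V1 ^t* \is unitarymx ->
  A *m V1 = U1 *m Sig1 -> U1 ^t* *m A = Sig1 *m V1 ^t* ->
  let Gap := smin Sh1 - spnorm A3 in
  let gap := smin Sig1 - spnorm Sh2 in
  0 < Gap -> 0 < gap ->
  forall N : forall p q, 'M[C]_(p, q) -> C, unitarily_invariant_norm N ->
  let Theta := Num.max (N _ _ (sin_angle U1 U1h)) (N _ _ (sin_angle V1 V1h)) in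
  let R := col_mx R1 R2 in
  let S := row_mx S1 S2 in
  let rho := Num.max (spnorm R2) (spnorm S2) in
  let kp := maxn (km - k1) (kn - k1) in
  let shat (j : nat) := if (j < minn km kn)%N then sh j else 0 in
  let t i := Num.max (rownorm R2 i) (colnorm S2 i) in
  let d i := smin Sig1 - shat (k1 + i)%N in
  let sum2 := \sum_(i < kp) (t i) ^+ 2 / d i in
  let sum1 := \sum_(i < kp) t i / d i in
  (* (i) *)
  Theta <= Num.max (N _ _ R) (N _ _ S) / Gap * (1 + rho / gap)
  (* (ii) *)
  /\ (rho ^+ 2 / gap < Gap ->
      Theta <= Num.max (N _ _ S1) (N _ _ R1) / (Gap - rho ^+ 2 / gap)
                 * (1 + rho / gap))
  (* (iii) *)
  /\ (sum2 < Gap ->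
      Theta <= Num.max (N _ _ S1) (N _ _ R1) / (Gap - sum2) * (1 + sum1)).
Proof.
move=> _ k1_gt0 k1_lt _ _ UU1 UU2 VV1 VV2 blk diagE sh_ge0 Sig1 U1U V1U AV UA.
move=> Gap gap Gap_gt0 gap_gt0 N Ninv Theta R S rho kp shat t d sum2 sum1.
have Sig1adj : Sig1^t* = Sig1.
  by apply: adj_diag_mx_real => i; rewrite mxE ger0_real // sing_val_ge0.
have AU : A^t* *m U1 = V1 *m Sig1.
  by rewrite -[A^t* *m U1]trmxCK adjmxM trmxCK UA adjmxM trmxCK Sig1adj.
(* The adjoint has the same block form with the two bases exchanged, so [block_rows] also yields the
   equations for [V2h] and [V3h]. *)
have blk' : (row_mx (row_mx V1h V2h) V3h)^t* *m A^t* *m row_mx (row_mx U1h U2h) U3h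
   = block_mx (block_mx (Sh1^t*) 0 0 (Sh2^t*)) (col_mx (S1^t*) (S2^t*))
              (row_mx (R1^t*) (R2^t*)) (A3^t*).
  have /= := congr1 (fun X => X^t*) blk.
  rewrite !adjmxM trmxCK mulmxA => ->.
  by rewrite !adj_block_mx adj_row_mx adj_col_mx !adjmx0.
have [eU2 eU3] := block_rows VV1 blk AV.
have [eV2 eV3] := block_rows UU1 blk' AU.
(* [row_mx U2h U3h] completes [U1h] to a unitary matrix; its two blocks are then separated. *)
have sinU : N _ _ (sin_angle U1 U1h) <= N _ _ (U2h^t* *m U1) + N _ _ (U3h^t* *m U1).
  apply: le_trans (uinorm_sin_angle Ninv (Xp := row_mx U2h U3h) (unitarymx_adj1 U1U) _) _.
    rewrite adj_row_mx mul_row_col addrA.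
    by move/unitarymxP: UU1; rewrite !adj_row_mx !mul_row_col.
  by rewrite adj_row_mx mul_col_mx uinorm_col_mx.
have sinV : N _ _ (sin_angle V1 V1h) <= N _ _ (V2h^t* *m V1) + N _ _ (V3h^t* *m V1).
  apply: le_trans (uinorm_sin_angle Ninv (Xp := row_mx V2h V3h) (unitarymx_adj1 V1U) _) _.
    rewrite adj_row_mx mul_row_col addrA.
    by move/unitarymxP: VV1; rewrite !adj_row_mx !mul_row_col.
  by rewrite adj_row_mx mul_col_mx uinorm_col_mx.
(* The full stack of three blocks is an isometry; dropping the third leaves a contraction. *)
have Ucontr : opbound 1 (col_mx (U1h^t* *m U1) (U2h^t* *m U1)).
  apply: (@opbound_usub _ _ _ _ _ _ (U3h^t* *m U1)); rewrite -!mul_col_mx -!adj_row_mx.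
  apply: opbound_isom; rewrite adjmxM trmxCK mulmxA -[_ *m _ *m _^t*]mulmxA.
  by rewrite (unitarymxP UU1) mulmx1 unitarymx_adj1.
have Vcontr : opbound 1 (col_mx (V1h^t* *m V1) (V2h^t* *m V1)).
  apply: (@opbound_usub _ _ _ _ _ _ (V3h^t* *m V1)); rewrite -!mul_col_mx -!adj_row_mx.
  apply: opbound_isom; rewrite adjmxM trmxCK mulmxA -[_ *m _ *m _^t*]mulmxA.
  by rewrite (unitarymxP VV1) mulmx1 unitarymx_adj1.
have smin_le : smin Sh1 <= smin Sig1.
  apply: smin_diag_ge; rewrite ?smin_ge0 // => i; rewrite mxE.
  exact: smin_block_le_sing_val UU1 VV2 blk (ltn_ord i).
move: eU2 eU3 eV2 eV3 sinU sinV Ucontr Vcontr.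
set U11 := U1h^t* *m U1; set U21 := U2h^t* *m U1; set U31 := U3h^t* *m U1.
set V11 := V1h^t* *m V1; set V21 := V2h^t* *m V1; set V31 := V3h^t* *m V1.
move=> eU2 eU3 eV2 eV3 sinU sinV Ucontr Vcontr.
clearbody U11 U21 U31 V11 V21 V31.
have Sig1_gt0 : 0 < smin Sig1.
  apply: lt_le_trans smin_le; apply: le_lt_trans (spnorm_ge0 A3) _.
  by rewrite -subr_gt0.
have Gap_le : Gap <= smin Sig1 - spnorm A3 by rewrite lerD2r.
have N0 := uinorm_ge0 Ninv.
have nA3 := opbound_spnorm A3; have pA3 := spnorm_ge0 A3.
have nS2 := opbound_spnorm S2; have pS2 := spnorm_ge0 S2.
have nR2 := opbound_spnorm R2; have pR2 := spnorm_ge0 R2.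
have nSh2 := opbound_spnorm Sh2; have pSh2 := spnorm_ge0 Sh2.
have rhoR : spnorm R2 <= rho by apply: ge0_le_maxl.
have rhoS : spnorm S2 <= rho by apply: ge0_le_maxr.
have rho0 : 0 <= rho by apply: le_trans rhoR.
pose M := Num.max (N _ _ U31) (N _ _ V31).
have MU : N _ _ U31 <= M by apply: ge0_le_maxl.
have MV : N _ _ V31 <= M by apply: ge0_le_maxr.
have M0 : 0 <= M by apply: le_trans MU.
have spb : spnorm Sh2 < smin Sig1 by rewrite -subr_gt0.
(* The second block rows are coupled through [spnorm Sh2], with residuals at most [rho * M]. *)
have UV2 : Num.max (N _ _ U21) (N _ _ V21) <= rho / gap * M.
  rewrite mulrAC; apply: coupled_max_le => //.
    apply: le_trans (uinorm_smin Ninv _ Sig1_gt0) _; rewrite -eU2.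
    apply: le_trans (uinormD Ninv _ _) _; apply: lerD; first exact: uinorm_mull.
    apply: le_trans (uinorm_mull Ninv _ pR2 nR2) _; exact: ler_pM.
  apply: le_trans (uinorm_smin Ninv _ Sig1_gt0) _; rewrite -eV2.
  apply: le_trans (uinormD Ninv _ _) _; apply: lerD.
    exact: uinorm_mull (opbound_adj pSh2 nSh2).
  apply: le_trans (uinorm_mull Ninv _ pS2 (opbound_adj pS2 nS2)) _; exact: ler_pM.
have U2M : N _ _ U21 <= rho / gap * M by apply: le_trans UV2; apply: ge0_le_maxl.
have V2M : N _ _ V21 <= rho / gap * M by apply: le_trans UV2; apply: ge0_le_maxr.
have rg0 : 0 <= rho / gap by rewrite divr_ge0 // ltW.
(* The residual stays unsplit: (i) bounds it whole, (ii) and (iii) term by term. *)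
have U3le : smin Sig1 * N _ _ U31 <=
    spnorm A3 * N _ _ V31 + N _ _ (S1 *m V11 + S2 *m V21).
  apply: le_trans (uinorm_smin Ninv _ Sig1_gt0) _; rewrite -eU3 addrC.
  apply: le_trans (uinormD Ninv _ _) _; apply: lerD => //; exact: uinorm_mull.
have V3le : smin Sig1 * N _ _ V31 <=
    spnorm A3 * N _ _ U31 + N _ _ (R1^t* *m U11 + R2^t* *m U21).
  apply: le_trans (uinorm_smin Ninv _ Sig1_gt0) _; rewrite -eV3 addrC.
  apply: le_trans (uinormD Ninv _ _) _; apply: lerD => //.
  exact: uinorm_mull (opbound_adj pA3 nA3).
(* (ii) and (iii) differ only in the factors [beta] for the second blocks and [gam] for the
   residuals they cause. *)
have Theta_le beta gam : 0 <= beta -> gam < Gap ->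
    N _ _ U21 <= beta * M -> N _ _ V21 <= beta * M ->
    N _ _ (S2 *m V21) <= gam * M -> N _ _ (R2^t* *m U21) <= gam * M ->
    Theta <= Num.max (N _ _ S1) (N _ _ R1) / (Gap - gam) * (1 + beta).
  move=> beta0 gam_lt U2b V2b S2b R2b.
  apply: (coupled_theta_le _ _ _ beta0 Gap_le gam_lt Gap_gt0 _ _ U2b V2b sinU sinV) => //.
    apply: le_trans U3le _; rewrite lerD2l.
    apply: le_trans (uinormD Ninv _ _) _; apply: lerD => //.
    apply: le_trans (uinorm_mulr Ninv _ ler01 (opbound_usub Vcontr)) _.
    by rewrite mul1r ge0_le_maxl.
  apply: le_trans V3le _; rewrite lerD2l.
  apply: le_trans (uinormD Ninv _ _) _; apply: lerD => //.
  apply: le_trans (uinorm_mulr Ninv _ ler01 (opbound_usub Ucontr)) _.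
  by rewrite mul1r uinorm_adj // ge0_le_maxr.
split; [|split=> [rho_lt|sum2_lt]].
(* (i): each residual is [S] or [R^t*] times a contraction, so nothing is absorbed and [gam] is
   [0]. *)
- rewrite -[Gap]subr0.
  apply: (coupled_theta_le _ _ _ rg0 Gap_le Gap_gt0 Gap_gt0 _ _ U2M V2M sinU sinV) => //.
    apply: le_trans U3le _; rewrite lerD2l mul0r addr0 -mul_row_col.
    apply: le_trans (uinorm_mulr Ninv _ ler01 Vcontr) _.
    by rewrite mul1r ge0_le_maxr.
  apply: le_trans V3le _; rewrite lerD2l mul0r addr0 -mul_row_col -adj_col_mx.
  apply: le_trans (uinorm_mulr Ninv _ ler01 Ucontr) _.
  by rewrite mul1r uinorm_adj // ge0_le_maxl.
(* (ii): one factor [rho] bounds [S2] or [R2], the other comes with [V2M] or [U2M]. *)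
- apply: Theta_le => //; rewrite expr2 -!mulrA [gap^-1 * M]mulrC [M * _]mulrC mulrA.
    apply: le_trans (uinorm_mull Ninv _ pS2 nS2) _.
    by rewrite -mulrA; apply: ler_pM; rewrite // mulrA.
  apply: le_trans (uinorm_mull Ninv _ pR2 (opbound_adj pR2 nR2)) _.
  by rewrite -mulrA; apply: ler_pM; rewrite // mulrA.
(* [shat (k1 + i)] is read from [sh] exactly when [i] indexes both a row and a column of [Sh2]. *)
have ltshat i : (k1 + i < minn km kn)%N = (i < km - k1)%N && (i < kn - k1)%N.
  by rewrite leq_min !ltn_subRL.
pose g i := shat (k1 + i)%N.
have g0 i : 0 <= g i by rewrite /g /shat; case: ifP => // /sh_ge0.
have Sh2g (i : 'I_(km - k1)) (j : 'I_(kn - k1)) :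
    Sh2 i j = if (i : nat) == j then g i else 0.
  have /matrixP/(_ (rshift k1 i) (rshift k1 j)) := diagE.
  rewrite block_mxEdr mxE /= eqn_add2l => ->; case: eqP => // ij.
  have ltij : (i < kn - k1)%N by rewrite ij.
  by rewrite /g /shat ltshat ltn_ord ltij.
have Sh2g' (i : 'I_(kn - k1)) (j : 'I_(km - k1)) :
    (Sh2^t*) i j = if (i : nat) == j then g i else 0.
  rewrite 2!mxE Sh2g eq_sym; case: eqP => [->|_]; last exact: conjC0.
  by apply/CrealP; rewrite ger0_real.
(* Either [g i] is the default [0], or it is a diagonal entry of [Sh2] and hence at most
   [spnorm Sh2]. *)
have g_lt i : g i < smin Sig1.
  apply: le_lt_trans spb; have [lti|] := boolP (k1 + i < minn km kn)%N; last first.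
    by rewrite /g /shat => /negPf->.
  move: lti; rewrite ltshat => /andP[li lj].
  have := norm_entry_le_spnorm Sh2 (Ordinal li) (Ordinal lj).
  by rewrite Sh2g eqxx ger0_norm.
have d_gt0 i : 0 < d i by rewrite subr_gt0; apply: g_lt.
have tR i : rownorm R2 i <= t i by apply: ge0_le_maxl; apply: rownorm_ge0.
have tS i : colnorm S2 i <= t i by apply: ge0_le_maxr; apply: rownorm_ge0.
have t0 i : 0 <= t i by apply: le_trans (tR i); apply: rownorm_ge0.
(* Row by row, [g i] replaces [spnorm Sh2] in the coupled inequalities, so [d i] replaces [gap]. *)
have rows i : Num.max (rowval N U21 i) (rowval N V21 i) <= t i / d i * M.
  rewrite mulrAC; apply: coupled_max_le (g0 i) (g_lt i) _ _; rewrite ?rowval_ge0 //.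
    apply: le_trans (rowval_bound Ninv i Sh2g g0 Sig1_gt0 eU2) _.
    by rewrite lerD2l ler_pM ?rownorm_ge0.
  apply: le_trans (rowval_bound Ninv i Sh2g' g0 Sig1_gt0 eV2) _.
  by rewrite lerD2l rownorm_adj ler_pM ?rownorm_ge0.
have rowU i : rowval N U21 i <= t i / d i * M.
  by apply: le_trans (rows i); apply: ge0_le_maxl; apply: rowval_ge0.
have rowV i : rowval N V21 i <= t i / d i * M.
  by apply: le_trans (rows i); apply: ge0_le_maxr; apply: rowval_ge0.
have td0 i : 0 <= t i / d i by rewrite divr_ge0 // ltW.
have ttd0 i : 0 <= t i ^+ 2 / d i by rewrite divr_ge0 ?exprn_ge0 // ltW.
have kpU : (km - k1 <= kp)%N by apply: leq_maxl.
have kpV : (kn - k1 <= kp)%N by apply: leq_maxr.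
(* (iii): [beta] is [sum1], from adding the row bounds; [gam] is [sum2], where each row bound gains
   one more factor [t i]. *)
apply: Theta_le => //.
- by rewrite sumr_ge0.
- apply: le_trans (uinorm_le_rows Ninv _) _.
  apply: le_trans (ler_wpM2r M0 (ler_sum_ord_widen kpU td0)).
  by rewrite mulr_suml ler_sum.
- apply: le_trans (uinorm_le_rows Ninv _) _.
  apply: le_trans (ler_wpM2r M0 (ler_sum_ord_widen kpV td0)).
  by rewrite mulr_suml ler_sum.
- apply: le_trans (uinorm_mul_rows Ninv _ _) _.
  apply: le_trans (ler_wpM2r M0 (ler_sum_ord_widen kpV ttd0)).
  rewrite mulr_suml ler_sum // => i _.
  by rewrite expr2 -2!mulrA; apply: ler_pM; rewrite ?rownorm_ge0 ?rowval_ge0 ?mulrA.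
- apply: le_trans (uinorm_mul_rows Ninv _ _) _.
  apply: le_trans (ler_wpM2r M0 (ler_sum_ord_widen kpU ttd0)).
  rewrite mulr_suml ler_sum // => i _.
  rewrite -rownorm_adj trmxCK.
  by rewrite expr2 -2!mulrA; apply: ler_pM; rewrite ?rownorm_ge0 ?rowval_ge0 ?mulrA.
Qed.
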